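(* Let $c\colon\mathbb{N}^2\to\{0,1\}$ be a symmetric colouring and $\prec$ its Erdős–Rado order. For every functional $\omega\colon \{0,1\}^{\mathbb{N}}\times\mathbb{N}^{\mathbb{N}}\to\mathbb{N}$ there exist $\alpha\colon\mathbb{N}\to\{0,1\}$ and $\beta\colon\mathbb{N}\to\mathbb{N}$ such that \[ \forall n\leq \omega\,\alpha\,\beta\ \ \exists k\in[n,\beta n]\ \forall i<n\ (\alpha(i)=0 \leftrightarrow i\prec k). \]
   Context: Let $\mathbb{B}=\{0,1\}$ and let $c\colon\mathbb{N}^2\to\mathbb{B}$ satisfy $c(i,j)=c(j,i)$. The Erdős–Rado order $\prec$ on $\mathbb{N}$ associated with $c$ is defined recursively: $0\prec 1$, and, given that $\prec$ is already defined on $\{0,\dots,j\}$, for $j<i$ one sets $j\prec i$ iff $c(k,i)=c(k,j)$ for all $k\prec j$. *)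

(* Defs.v *)
(* MathComp.  The colours 0 and 1 are the booleans false and true. *)
From mathcomp Require Import all_boot.

Set Implicit Arguments.
Unset Strict Implicit.
Unset Printing Implicit Defensive.

(* Whether j precedes i depends on the predecessors of j only, and only for
   j < i, so i rounds of unfolding determine the predecessors of i;
   erdos_radoE is the resulting recursion, free of the counter n. *)
Fixpoint erdos_rado_rec (c : nat -> nat -> bool) (n j i : nat) : bool :=
  if n is n'.+1 then
    (j < i) && [forall k : 'I_j, erdos_rado_rec c n' k j ==> (c k i == c k j)]
  else false.

Definition erdos_rado (c : nat -> nat -> bool) (j i : nat) : bool :=
  erdos_rado_rec c i j i.

Lemma erdos_rado_recE c n j i : i <= n ->
  erdos_rado_rec c n j i = erdos_rado c j i.
Proof.
rewrite /erdos_rado; elim/ltn_ind: n i j => -[|n] IHn i j /=.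
  by rewrite leqn0 => /eqP->.
case: i => [|i] //= le_in; case: (ltnP j i.+1) => //= le_ji.
apply: eq_forallb => k.
by rewrite (IHn n) ?(IHn i) // (@leq_trans i).
Qed.

Lemma erdos_radoE c j i :
  erdos_rado c j i <->
  j < i /\ (forall k, erdos_rado c k j -> c k i = c k j).
Proof.
rewrite -(@erdos_rado_recE c i.+1) //=; split.
  case/andP=> lt_ji /forallP Hc; split=> // k k_j.
  have lt_kj : k < j.
    by move: k_j; rewrite /erdos_rado; case: j {lt_ji Hc} => //= j /andP[].
  by have := Hc (Ordinal lt_kj); rewrite /= erdos_rado_recE ?k_j 1?ltnW // => /eqP.
case=> lt_ji Hc; rewrite lt_ji /=; apply/forallP=> k; apply/implyP.
by rewrite erdos_rado_recE 1?ltnW // => /Hc->.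
Qed.

Lemma erdos_rado01 c : erdos_rado c 0 1.
Proof. by apply/erdos_radoE; split=> // k /erdos_radoE[]. Qed.

(* Main.v *)
(* Regard the set of predecessors of k as a point of the Cantor space.  By
   compactness these points have a cluster point as k tends to infinity; take
   for alpha the complement of its characteristic function.  The required k then
   exists for every n, and beta n can be the least one. *)
Require Import Defs.
From mathcomp Require Import all_boot.
From Stdlib Require Import ClassicalEpsilon.

Definition unbounded (P : pred nat) : Prop :=
  forall m, exists2 k, m <= k & P k.

Lemma unbounded_split (P Q : pred nat) :
  unbounded P -> ~ unbounded (predI P Q) -> unbounded (predI P (predC Q)).
Proof.
move=> infP finPQ m; apply: NNPP => no_k; apply: finPQ => m'.
(* A point of [P] beyond both bounds: being past [m] it must lie in [Q], and it is past the
   arbitrary [m']. *)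
have [k le_k Pk] := infP (maxn m m').
move: le_k; rewrite geq_max => /andP[le_mk le_m'k].
exists k => //=; rewrite Pk /=; apply/negPn/negP => nQk.
by apply: no_k; exists k; rewrite //= Pk.
Qed.

(** The bits of [a] are fixed greedily, one at a time, so that unboundedly many [k] still agree with
    all bits fixed so far. *)
Lemma cantor_cluster_point (f : nat -> nat -> bool) :
  exists a : nat -> bool,
    forall n, unbounded (fun k => [forall i : 'I_n, f k i == a i]).
Proof.
(* The bit [true] is preferred; [false] is taken only when [true] would leave a bounded set, and
   [unbounded_split] then makes it safe. *)
pose b (P : pred nat) n : bool :=
  excluded_middle_informative (unbounded (predI P (f^~ n))).
pose fix P n : pred nat :=
  if n is n'.+1 then predI (P n') (fun k => f k n' == b (P n') n') else predT.
have infP n : unbounded (P n).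
  elim: n => [m|n IHn]; first by exists m.
  have [b_n|b_n] := excluded_middle_informative (unbounded (predI (P n) (f^~ n))).
    move=> m; have [k le_mk /andP[Pk fkn]] := b_n m.
    by exists k => //=; rewrite Pk fkn /b; case: excluded_middle_informative.
  move=> m; have [k le_mk /andP[Pk fkn]] := unbounded_split _ _ IHn b_n m.
  exists k => //=; rewrite Pk /b; case: excluded_middle_informative => //= _.
  by rewrite eqbF_neg.
have P_agree n k i : P n k -> i < n -> f k i = b (P i) i.
  elim: n => //= n IHn /andP[Pk /eqP fkn].
  by rewrite ltnS leq_eqVlt => /predU1P[->|/IHn->].
exists (fun n => b (P n) n) => n m; have [k le_mk Pk] := infP n m.
by exists k => //; apply/forallP => i; apply/eqP/(P_agree n).
Qed.

Theorem theorem4p8 (c : nat -> nat -> bool)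
    (c_sym : forall i j : nat, c i j = c j i)
    (omega : (nat -> bool) -> (nat -> nat) -> nat) :
  exists (alpha : nat -> bool) (beta : nat -> nat),
    forall n : nat, n <= omega alpha beta ->
      exists k : nat, n <= k <= beta n /\
        (forall i : nat, i < n -> (alpha i = false <-> erdos_rado c i k)).
Proof.
have [a a_cluster] := cantor_cluster_point (fun k i => erdos_rado c i k).
pose good n k := (n <= k) && [forall i : 'I_n, erdos_rado c i k == a i].
have good_ex n : exists k, good n k.
  (* Here [n] is both the length of the prefix and the lower bound for [k]. *)
  by have [k le_nk ak] := a_cluster n n; exists k; apply/andP.
exists (fun i => ~~ a i), (fun n => ex_minn (good_ex n)) => n _.
case: ex_minnP => k /andP[le_nk /forallP ak] _; exists k; split.
  by rewrite le_nk leqnn.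
move=> i lt_in; have /eqP /= -> := ak (Ordinal lt_in).
by split=> [/negbFE|->].
Qed.
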